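(* Let $\mathcal H$ be a multiplier stable Hilbert function space of continuous functions on a separable topological space $\Omega$, containing the constant functions with $\|1\|_{\mathcal H}=1$, and assume that $\mathcal H$ has the Montel property. Let $N\ge1$, suppose that $\varphi\in\oplus_{\ell=1}^N L^\infty(\Omega)$, i.e. $\varphi=(\varphi_1,\dots,\varphi_N)$ is an $N$-tuple of bounded complex-valued functions on $\Omega$, and let $C>0$. Then there is a vector function $f\in\oplus^N K_{\mathcal H}$ satisfying $$\varphi(z)\cdot f(z)=1\quad(z\in\Omega),\qquad \|f\|_{\oplus^N K_{\mathcal H}}\le C,$$ if and only if $\varphi$ satisfies the $\mathcal H$-convex Poisson condition with constant $\|\varphi\|_{\mathcal H-cPc}\le C$.
   Context: A Hilbert function space $\mathcal H$ on a set $\Omega$ is a Hilbert space of complex-valued functions on $\Omega$ (pointwise operations) for which every point evaluation is a nonzero continuous linear functional. $k_x\in\mathcal H$ denotes the reproducing kernel, $f(x)=\langle f,k_x\rangle_{\mathcal H}$, and $\widetilde{k_x}=k_x/\sqrt{k_x(x)}$. $M_{\mathcal H}$ is the algebra of functions $\psi$ on $\Omega$ with $\psi f\in\mathcal H$ for all $f\in\mathcal H$, normed by the operator norm of $f\mapsto\psi f$ on $\mathcal H$. Multiplier stable: (i) the reproducing kernel functions $k_x$ are nonvanishing and are invertible multipliers on $\mathcal H$, i.e. $k_x\in M_{\mathcal H}$ and $1/k_x\in M_{\mathcal H}$, for all $x\in\Omega$; and (ii) the map $x\mapsto k_x$ from $\Omega$ to $M_{\mathcal H}$ is lower semicontinuous.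 Montel property: there is a dense subset $S$ of $\Omega$ such that every sequence in the unit ball of $\mathcal H$ has a subsequence converging pointwise on $S$ to some $g$ in the unit ball of $\mathcal H$. $\varphi\cdot f=\sum_{\ell=1}^N\varphi_\ell f_\ell$ (no conjugation); $\|f\|_{\oplus^N\mathcal H}^2=\sum_{\ell=1}^N\|f_\ell\|_{\mathcal H}^2$. $K_{\mathcal H}$ (kernel multipliers) is the space of functions $\psi$ on $\Omega$ with $\max\{\|\psi\|_{\mathcal H},\sup_{a\in\Omega}\|\psi\widetilde{k_a}\|_{\mathcal H}\}<\infty$, and $\|f\|_{\oplus^N K_{\mathcal H}}=\max\{\|f\|_{\oplus^N\mathcal H},\sup_{a\in\Omega}\|f\widetilde{k_a}\|_{\oplus^N\mathcal H}\}$. $\mathcal H$-convex Poisson condition with positive constant $C$ for $\varphi$: for every finite collection of points $\mathbf a=(a_1,\dots,a_M)\in\Omega^M$ and every collection of nonnegative numbers $\theta_0,\dots,\theta_M$ with $\sum_{m=0}^M\theta_m=1$, there is $g\in\oplus^N\mathcal H$ (depending on $\mathbf a$ and $\theta$) with $\varphi(z)\cdot g(z)=1$ for all $z\in\Omega$ and $$\theta_0\|g\|_{\oplus^N\mathcal H}^2+\sum_{m=1}^M\theta_m\|\widetilde{k_{a_m}}g\|_{\oplus^N\mathcal H}^2\le C^2.$$ The smallest such constant $C$ is denoted $\|\varphi\|_{\mathcal H-cPc}$. *)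

(* Defs.v *)
(* MathComp-Analysis; the complex numbers are R[i] for an arbitrary R : realType. *)
From HB Require Import structures.
From mathcomp Require Import all_boot all_order all_algebra.
From mathcomp Require Import all_classical all_reals all_analysis.
From mathcomp.real_closed Require Export complex.
Export Order.TTheory GRing.Theory Num.Theory numFieldNormedType.Exports.

Set Implicit Arguments.
Unset Strict Implicit.
Unset Printing Implicit Defensive.

Local Open Scope classical_set_scope.
Local Open Scope ring_scope.
Local Open Scope complex_scope.

(* The elements of the space form the subset [hfs_mem] of T -> R[i].  The inner
   product [hdot] is a total function, but only its values on pairs of elements
   of that subset are constrained and used; it is linear in its first argument.
   [dot_norm] is only meaningful on elements of the space. *)
Definition dot_norm (R : realType) (T : Type)
    (dot : (T -> R[i]) -> (T -> R[i]) -> R[i]) (f : T -> R[i]) : R :=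
  Num.sqrt (complex.Re (dot f f)).

Record hilbertFunctionSpace (R : realType) (T : Type) := HilbertFunctionSpace {
  hfs_mem :> (T -> R[i]) -> Prop;
  hdot : (T -> R[i]) -> (T -> R[i]) -> R[i];
  hfs0 : hfs_mem (cst 0);
  hfsD : forall f g, hfs_mem f -> hfs_mem g -> hfs_mem (f \+ g);
  hfsZ : forall (a : R[i]) f, hfs_mem f -> hfs_mem (cst a \* f);
  hdotDl : forall f g h, hfs_mem f -> hfs_mem g -> hfs_mem h ->
    hdot (f \+ g) h = hdot f h + hdot g h;
  hdotZl : forall (a : R[i]) f h, hfs_mem f -> hfs_mem h ->
    hdot (cst a \* f) h = a * hdot f h;
  hdotC : forall f g, hfs_mem f -> hfs_mem g -> hdot f g = (hdot g f)^*%C;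
  hdot_gt0 : forall f, hfs_mem f -> f <> cst 0 -> 0 < hdot f f;
  hfs_complete : forall u : nat -> T -> R[i],
    (forall n, hfs_mem (u n)) ->
    (forall e : R, 0 < e -> exists n0 : nat, forall m n : nat,
       (n0 <= m)%N -> (n0 <= n)%N -> dot_norm hdot (u m \- u n) < e) ->
    exists2 g, hfs_mem g & dot_norm hdot (u n \- g) @[n --> \oo] --> (0 : R);
  hfs_eval_continuous : forall (x : T) f, hfs_mem f ->
    forall e : R, 0 < e -> exists2 d : R, 0 < d &
      forall g, hfs_mem g -> dot_norm hdot (g \- f) < d -> `|g x - f x| < e%:C;
  hfs_eval_neq0 : forall x : T, exists2 f, hfs_mem f & f x != 0 }.

Section HilbertFunctionSpace.
Variables (R : realType) (T : Type) (H : hilbertFunctionSpace R T).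

(* Norms are extended to all functions by +oo outside the space. *)
Definition hnorm (f : T -> R[i]) : \bar R :=
  if `[< H f >] then (dot_norm (hdot H) f)%:E else +oo%E.

Definition hnorm_tuple (N : nat) (f : 'I_N -> T -> R[i]) : \bar R :=
  if `[< forall l, H (f l) >]
  then (Num.sqrt (\sum_(l < N) dot_norm (hdot H) (f l) ^+ 2))%:E else +oo%E.

(* Existence (and uniqueness) of the element picked here is the Riesz
   representation theorem. *)
Definition rkernel (x : T) : T -> R[i] :=
  xget (cst 0) [set k | H k /\ forall f, H f -> f x = hdot H f k].

Definition nkernel (x : T) : T -> R[i] :=
  fun y => rkernel x y / sqrtC (rkernel x x).

Definition multiplier (psi : T -> R[i]) : Prop :=
  forall f, H f -> H (psi \* f).

Definition multiplier_norm (psi : T -> R[i]) : \bar R :=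
  ereal_sup [set hnorm (psi \* f) | f in [set f | (hnorm f <= 1)%E]].

Definition kernel_multiplier (psi : T -> R[i]) : Prop :=
  (maxe (hnorm psi)
        (ereal_sup (range (fun a => hnorm (psi \* nkernel a)%R))) < +oo)%E.

Definition kernel_multiplier_norm_tuple (N : nat) (f : 'I_N -> T -> R[i]) : \bar R :=
  maxe (hnorm_tuple f)
       (ereal_sup (range (fun a => hnorm_tuple (fun l => f l \* nkernel a)))).

Definition bezout (N : nat) (phi f : 'I_N -> T -> R[i]) : Prop :=
  forall z, \sum_(l < N) phi l z * f l z = 1.

Definition convex_Poisson (N : nat) (phi : 'I_N -> T -> R[i]) (C : R) : Prop :=
  0 < C /\
  forall (M : nat) (a : 'I_M -> T) (theta0 : R) (theta : 'I_M -> R),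
    0 <= theta0 -> (forall m, 0 <= theta m) ->
    theta0 + \sum_(m < M) theta m = 1 ->
    exists g : 'I_N -> T -> R[i],
      [/\ forall l, H (g l), bezout phi g &
        (theta0%:E * hnorm_tuple g ^+ 2
         + \sum_(m < M) (theta m)%:E
             * hnorm_tuple (fun l => nkernel (a m) \* g l)%R ^+ 2 <= (C ^+ 2)%:E)%E].

(* [c] is the smallest constant for which the condition holds. *)
Definition is_convex_Poisson_norm (N : nat) (phi : 'I_N -> T -> R[i]) (c : R) :
    Prop :=
  convex_Poisson phi c /\ forall c', convex_Poisson phi c' -> c <= c'.

End HilbertFunctionSpace.

Section Topological.
Variables (R : realType) (Omega : topologicalType).
Variable H : hilbertFunctionSpace R Omega.

Definition separable : Prop :=
  exists2 S : set Omega, countable S & dense S.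

(* Lower semicontinuity of the map x |-> k_x into the normed algebra of
   multipliers means that of x |-> the multiplier norm of k_x. *)
Definition multiplier_stable : Prop :=
  (forall x : Omega,
    [/\ forall y, rkernel H x y != 0,
        multiplier H (rkernel H x) &
        multiplier H (fun y => (rkernel H x y)^-1)]) /\
  lower_semicontinuous (fun x : Omega => multiplier_norm H (rkernel H x)).

(* Pointwise limits are taken in R[i]^o, which carries the norm topology. *)
Definition Montel : Prop :=
  exists2 S : set Omega, dense S &
    forall u : nat -> Omega -> R[i], (forall n, (hnorm H (u n) <= 1)%E) ->
    exists2 sigma : nat -> nat, {homo sigma : m n / (m < n)%N} &
    exists2 g : Omega -> R[i], (hnorm H g <= 1)%E &
      forall z, S z -> (u (sigma n) z : R[i]^o) @[n --> \oo] --> (g z : R[i]^o).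

End Topological.

(* Main.v *)
(* The map [g |-> k g], [k] a normalized kernel, is a linear operator on the
   Hilbert space H^N. For finitely many points, the squared norms of [g] and of
   the [k g] are convex functions of [g] on the affine set of solutions of
   [phi . g = 1], so a minimax argument turns the weighted inequalities of the
   convex Poisson condition into one solution for which all these norms are at
   most [C + e]. As the finite set of points grows and [e] decreases, the
   corresponding solution sets form a directed family of nonempty bounded convex
   sets in H^N; elements of nearly minimal norm converge, by the parallelogram
   law, to a point [u] in the closure of all of them. The same convergence result
   applied to the sets [k g], [g] near [u], shows that [k u] has norm at most
   [C], point evaluations identifying the limit; the multiplier operators need
   not be known to be bounded. Since slack is allowed in the hypothesis, the
   argument also shows that the infimum of the admissible constants is attained. *)
Require Import Defs.
From mathcomp Require Import all_boot all_order all_algebra.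
From mathcomp Require Import all_classical all_reals all_analysis.
From mathcomp Require Import lra ring.

Set Implicit Arguments.
Unset Strict Implicit.
Unset Printing Implicit Defensive.

Local Open Scope classical_set_scope.
Local Open Scope ring_scope.
Local Open Scope complex_scope.

Lemma ler_invS (R : realType) (m n : nat) :
  (m <= n)%N -> n.+1%:R^-1 <= m.+1%:R^-1 :> R.
Proof. by move=> mn; rewrite lef_pV2 ?posrE ?ltr0n// ler_nat ltnS. Qed.

Lemma invS_small (R : realType) (e : R) : 0 < e -> exists n, n.+1%:R^-1 < e.
Proof.
move=> e0; exists (Num.truncn e^-1).
by rewrite invf_plt ?posrE ?ltr0n// truncnS_gt.
Qed.

(** * Geometry of a Hilbert function space *)

Definition wmean (R : realType) (T : Type) (s : R) (f g : T -> R[i]) : T -> R[i] :=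
  (cst s%:C \* f) \+ (cst (1 - s)%:C \* g).

Section Geometry.
Variables (R : realType) (T : Type) (H : hilbertFunctionSpace R T).
Implicit Types (f g h : T -> R[i]) (s t : R).

Definition hsq f : R := complex.Re (hdot H f f).
Definition nrm f : R := dot_norm (hdot H) f.

Lemma hfs_wmean s f g : H f -> H g -> H (wmean s f g).
Proof. by move=> Hf Hg; apply: hfsD; apply: hfsZ. Qed.

Lemma hfs_opp f : H f -> H (\- f).
Proof.
move=> Hf; have -> : \- f = cst (-1) \* f by apply/funext => x /=; rewrite mulN1r.
exact: hfsZ.
Qed.

Lemma hfsB f g : H f -> H g -> H (f \- g).
Proof. by move=> Hf Hg; exact: (hfsD Hf (hfs_opp Hg)). Qed.

Lemma hdot0 : hdot H (cst 0) (cst 0) = 0.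
Proof.
have -> : hdot H (cst 0) (cst 0) = hdot H (cst 0 \* cst 0) (cst 0).
  by congr (hdot H _ _); apply/funext => x /=; rewrite mul0r.
by rewrite (hdotZl _ (hfs0 H) (hfs0 H)) mul0r.
Qed.

Lemma hdot_ge0 f : H f -> 0 <= hdot H f f.
Proof.
move=> Hf; have [->|/(hdot_gt0 Hf)/ltW//] := pselect (f = cst 0).
by rewrite hdot0.
Qed.

Lemma hsq_ge0 f : H f -> 0 <= hsq f.
Proof. by move/hdot_ge0; rewrite lecE => /andP[]. Qed.

Lemma nrm_ge0 f : 0 <= nrm f.
Proof. exact: sqrtr_ge0. Qed.

Lemma nrm_sqr f : H f -> nrm f ^+ 2 = hsq f.
Proof. by move=> Hf; rewrite sqr_sqrtr ?hsq_ge0. Qed.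

Lemma nrm_le f (r : R) : H f -> 0 <= r -> (nrm f <= r) = (hsq f <= r ^+ 2).
Proof. by move=> Hf r0; rewrite -nrm_sqr// ler_pXn2r// nnegrE nrm_ge0. Qed.

Lemma nrm_eq0 f : H f -> nrm f = 0 -> f = cst 0.
Proof.
move=> Hf f0; have [//|/(hdot_gt0 Hf)] := pselect (f = cst 0).
rewrite ltcE => /andP[_]; rewrite -/(hsq f) -nrm_sqr// f0 expr0n /=.
by rewrite ltxx.
Qed.

Lemma hdotDr f g h : H f -> H g -> H h ->
  hdot H h (f \+ g) = hdot H h f + hdot H h g.
Proof.
move=> Hf Hg Hh; rewrite (hdotC Hh (hfsD Hf Hg)) hdotDl//.
by rewrite (hdotC Hh Hf) (hdotC Hh Hg) rmorphD.
Qed.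

Lemma hdotZr (a : R[i]) f h : H f -> H h ->
  hdot H h (cst a \* f) = a^*%C * hdot H h f.
Proof.
move=> Hf Hh; by rewrite (hdotC Hh (hfsZ a Hf)) hdotZl// (hdotC Hh Hf) rmorphM.
Qed.

Lemma Re_real_mul s (z : R[i]) : complex.Re (s%:C * z) = s * complex.Re z.
Proof. by case: z => a b /=; rewrite mul0r subr0. Qed.

Lemma hsq_comb s t f g : H f -> H g ->
  hsq ((cst s%:C \* f) \+ (cst t%:C \* g)) =
  s ^+ 2 * hsq f + t ^+ 2 * hsq g + s * t * (2 * complex.Re (hdot H f g)).
Proof.
move=> Hf Hg; have Hsf : H (cst s%:C \* f) by exact: hfsZ.
have Htg : H (cst t%:C \* g) by exact: hfsZ.
rewrite /hsq hdotDl//; last exact: hfsD.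
rewrite !hdotDr// !hdotZl// !hdotZr// (hdotC Hg Hf).
have cR (r : R) : (r%:C^*)%C = r%:C by rewrite /conjc /= oppr0.
rewrite !cR !raddfD /= !Re_real_mul.
have -> : complex.Re (hdot H f g)^*%C = complex.Re (hdot H f g) by case: (hdot H f g).
by ring.
Qed.

Lemma hsqZ s f : H f -> hsq (cst s%:C \* f) = s ^+ 2 * hsq f.
Proof.
move=> Hf; have := hsq_comb s 0 Hf Hf.
rewrite expr0n /= mul0r mulr0 mul0r !addr0 => <-; congr hsq.
by apply/funext => x /=; rewrite mul0r addr0.
Qed.

Lemma nrmZ s f : H f -> 0 <= s -> nrm (cst s%:C \* f) = s * nrm f.
Proof.
move=> Hf s0; rewrite /nrm /dot_norm -[complex.Re _]/(hsq _) hsqZ//.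
by rewrite sqrtrM ?sqr_ge0// sqrtr_sqr ger0_norm.
Qed.

Lemma hsqB f g : H f -> H g -> hsq (f \- g) =
  hsq f + hsq g - 2 * complex.Re (hdot H f g).
Proof.
move=> Hf Hg; have -> : f \- g = (cst 1%:C \* f) \+ (cst (-1)%:C \* g).
  by apply/funext => x /=; rewrite rmorphN rmorph1 mul1r mulN1r.
by rewrite hsq_comb//; ring.
Qed.

(** At [s = 2^-1] this is the parallelogram law, which makes near-minimal elements close to one
    another. Dropping the last, nonpositive term for [s] in [0, 1] gives convexity of the squared
    norm. *)
Lemma hsq_wmean s f g : H f -> H g ->
  hsq (wmean s f g) = s * hsq f + (1 - s) * hsq g - s * (1 - s) * hsq (f \- g).
Proof. by move=> Hf Hg; rewrite hsq_comb// hsqB//; ring. Qed.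

Lemma hsq_convex s f g : 0 <= s <= 1 -> H f -> H g ->
  hsq (wmean s f g) <= s * hsq f + (1 - s) * hsq g.
Proof.
move=> /andP[s0 s1] Hf Hg; rewrite hsq_wmean// gerBl.
by rewrite !mulr_ge0 ?subr_ge0// hsq_ge0//; exact: hfsB.
Qed.

(* Write [f + g = s (f / s) + (1 - s) (g / (1 - s))] with [s = a / (a + b)],
   where [a] and [b] are slightly larger than the norms, and use convexity. *)
Lemma nrmD f g : H f -> H g -> nrm (f \+ g) <= nrm f + nrm g.
Proof.
move=> Hf Hg; apply/ler_addgt0Pr => e e0.
set a := nrm f + e / 2; set b := nrm g + e / 2.
have a0 : 0 < a by rewrite ltr_wpDl ?nrm_ge0// divr_gt0.
have b0 : 0 < b by rewrite ltr_wpDl ?nrm_ge0// divr_gt0.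
have ab0 : 0 < a + b by rewrite addr_gt0.
have -> : nrm f + nrm g + e = a + b by rewrite /a /b; field.
have Hfg := hfsD Hf Hg.
rewrite nrm_le//; last exact: ltW.
set s := a / (a + b).
have sE : 1 - s = b / (a + b) by rewrite /s; field; rewrite gt_eqF.
have -> : f \+ g = wmean s (cst s^-1%:C \* f) (cst (1 - s)^-1%:C \* g).
  apply/funext => x; rewrite /wmean /= !mulrA -!rmorphM.
  rewrite !mulfV ?rmorph1 ?mul1r// ?sE ?mulf_neq0 ?invr_eq0 ?gt_eqF//.
have s01 : 0 <= s <= 1.
  by apply/andP; split; [rewrite divr_ge0 ?ltW | rewrite ler_pdivrMr// mul1r lerDl ltW].
apply: le_trans (hsq_convex s01 (hfsZ _ Hf) (hfsZ _ Hg)) _.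
rewrite !hsqZ// sE /s -!nrm_sqr//.
have fa : nrm f ^+ 2 <= a ^+ 2.
  by rewrite ler_pXn2r// ?nnegrE ?nrm_ge0 ?ltW// ltrDl divr_gt0.
have gb : nrm g ^+ 2 <= b ^+ 2.
  by rewrite ler_pXn2r// ?nnegrE ?nrm_ge0 ?ltW// ltrDl divr_gt0.
have -> : a / (a + b) * ((a / (a + b))^-1 ^+ 2 * nrm f ^+ 2) +
  b / (a + b) * ((b / (a + b))^-1 ^+ 2 * nrm g ^+ 2) =
  (a + b) * (nrm f ^+ 2 / a + nrm g ^+ 2 / b).
  by field; rewrite !gt_eqF.
rewrite expr2 ler_pM2l// lerD// ler_pdivrMr// -expr2//.
Qed.

Lemma nrmBC f g : H f -> H g -> nrm (f \- g) = nrm (g \- f).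
Proof.
move=> Hf Hg; rewrite /nrm /dot_norm; congr Num.sqrt.
rewrite -!/(hsq _) !hsqB// (hdotC Hg Hf).
have -> : complex.Re (hdot H f g)^*%C = complex.Re (hdot H f g) by case: (hdot H f g).
by rewrite (addrC (hsq g)).
Qed.

Lemma nrmB_trans h f g : H f -> H g -> H h ->
  nrm (f \- g) <= nrm (f \- h) + nrm (h \- g).
Proof.
move=> Hf Hg Hh; have -> : f \- g = (f \- h) \+ (h \- g).
  by apply/funext => x /=; rewrite addrA subrK.
by apply: nrmD; exact: hfsB.
Qed.

(** Continuity at the zero function bounds the values at [x] on a ball of radius [d], and rescaling
    carries the bound to every element. *)
Lemma eval_bounded x : exists2 c : R, 0 <= c &
  forall f, H f -> `|f x| <= (c * nrm f)%:C.
Proof.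
have [d d0 Hd] := hfs_eval_continuous x (hfs0 H) ltr01.
exists (2 / d); first by rewrite divr_ge0// ltW.
move=> f Hf.
suff fx : complex.Re `|f x| <= 2 / d * nrm f.
  by rewrite lecE; apply/andP; split => //; rewrite normc_def /= eqxx.
apply/ler_addgt0Pr.
(* The added [e] keeps [r] positive, so an element of norm zero needs no separate case; [f] divided
   by [r] lies in the ball of radius [d]. *)
move=> e e0; set r := 2 / d * nrm f + e.
have r0 : 0 < r by rewrite ltr_wpDl// mulr_ge0 ?nrm_ge0// divr_ge0// ltW.
have := Hd _ (hfsZ r^-1%:C Hf).
have -> : (cst r^-1%:C \* f) \- cst 0 = cst r^-1%:C \* f.
  by apply/funext => y /=; rewrite subr0.
rewrite -/(nrm _) nrmZ//; last by rewrite invr_ge0 ltW.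
have -> : r^-1 * nrm f < d.
  rewrite mulrC ltr_pdivrMr// /r mulrDr mulrA mulrCA mulfV ?gt_eqF// mulr1.
  have := nrm_ge0 f; have := mulr_gt0 d0 e0; lra.
move=> /(_ isT); rewrite /= subr0 normrM.
have -> : `|r^-1%:C| = r^-1%:C :> R[i] by rewrite ger0_norm// lecR invr_ge0 ltW.
rewrite ltcE => /andP[_]; rewrite Re_real_mul.
rewrite [complex.Re 1]/= mulrC ltr_pdivrMr// mul1r; exact: ltW.
Qed.

End Geometry.

(** * Limits of near-minimal elements in directed families *)

Section Adherent.
Variables (R : realType) (T : Type) (H : hilbertFunctionSpace R T).

(* The near-minimal elements of the [E i] form a Cauchy filter base, by the
   parallelogram law; its limit is the required point. *)
Lemma directed_adherent (I : Type) (E : I -> (T -> R[i]) -> Prop) (B : R) :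
  inhabited I ->
  (forall i f, E i f -> H f) ->
  (forall i f g, E i f -> E i g -> E i (wmean 2^-1 f g)) ->
  (forall i j, exists k, forall f, E k f -> E i f /\ E j f) ->
  (forall i, exists2 f, E i f & nrm H f <= B) ->
  exists2 u, H u &
    forall i e, 0 < e -> exists2 f, E i f & nrm H (f \- u) < e.
Proof.
move=> [i0] EH Emid Edir EB.
(* [sup D] is the supremum over [i] of the infimum of the squared norm on [E i]. *)
pose D := [set r : R | exists i, forall f, E i f -> r <= hsq H f].
have DB : ubound D (B ^+ 2).
  move=> r [i ri]; have [f fE fB] := EB i; apply: le_trans (ri f fE) _.
  have B0 : 0 <= B by exact: le_trans (nrm_ge0 _ _) fB.
  by rewrite -(nrm_le (EH _ _ fE)).
have supD : has_sup D.
  by split; [exists 0, i0 => f /EH; exact: hsq_ge0 | exists (B ^+ 2)].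
set d := sup D.
have near_min i e : 0 < e -> exists2 f, E i f & hsq H f <= d + e.
  move=> e0; apply: contrapT => Nf.
  suff : d + e <= d by rewrite gerDl leNgt e0.
  apply: ub_le_sup; first by exists (B ^+ 2).
  exists i => f fE; rewrite leNgt; apply/negP => /ltW fd; apply: Nf.
  by exists f.
have small e : 0 < e -> exists i, exists2 a, 0 < a & forall f g, E i f -> E i g ->
    hsq H f <= d + a -> hsq H g <= d + a -> nrm H (f \- g) <= e.
  (* The midpoint of [f] and [g] lies in [E i], so its squared norm exceeds [d - a]. The
     parallelogram law then bounds the squared distance by [4 * (d + a) - 4 * (d - a) = 8 * a],
     which is [e ^+ 2]. *)
  move=> e0; have a0 : 0 < e ^+ 2 / 8 by rewrite divr_gt0// exprn_gt0.
  have [r [i ri] dr] := sup_adherent a0 supD.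
  exists i, (e ^+ 2 / 8) => // f g fE gE fd gd.
  have [Hf Hg] := (EH _ _ fE, EH _ _ gE).
  rewrite nrm_le; [|exact: hfsB|exact: ltW].
  have := ri _ (Emid _ _ _ fE gE); rewrite hsq_wmean//.
  rewrite -/d in dr; lra.
pose e_ (n : nat) : R := n.+1%:R^-1.
have e_gt0 n : 0 < e_ n by rewrite invr_gt0 ltr0n.
have e_le m n : (m <= n)%N -> e_ n <= e_ m by exact: ler_invS.
have e_small e : 0 < e -> exists n, e_ n < e by exact: invS_small.
have /choice[K HK] n : exists p : I * R, 0 < p.2 /\
    forall f g, E p.1 f -> E p.1 g ->
    hsq H f <= d + p.2 -> hsq H g <= d + p.2 -> nrm H (f \- g) <= e_ n.
  by have [i [a a0 Ha]] := small _ (e_gt0 n); exists (i, a).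
have /choice[w Hw] n : exists f, E (K n).1 f /\ hsq H f <= d + (K n).2.
  by have [f fE fd] := near_min (K n).1 _ (HK n).1; exists f.
have wH n : H (w n) by exact: EH (Hw n).1.
(* A near-minimal element of a set below both [E i] and [E (K n).1] is close to [w n] by the choice
   of [K n]. This links the sequence to every member of the family. *)
have meet i a n : 0 < a ->
    exists f, [/\ E i f, hsq H f <= d + a & nrm H (w n \- f) <= e_ n].
  move=> a0; have [k kE] := Edir i (K n).1.
  have [|f fE fd] := near_min k (Num.min a (K n).2).
    by rewrite lt_min a0 (HK n).1.
  have [fi fK] := kE f fE; have [wE wd] := Hw n.
  exists f; split => //; first by apply: le_trans fd _; rewrite lerD2l ge_min lexx.
  apply: (HK n).2 => //; apply: le_trans fd _.
  by rewrite lerD2l ge_min lexx orbT.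
have w_cauchy m n : nrm H (w m \- w n) <= e_ m + e_ n.
  have [f [fE fd fm]] := meet (K n).1 _ m (HK n).1.
  have Hf := EH _ _ fE.
  apply: le_trans (nrmB_trans (wH m) (wH n) Hf) _; apply: lerD => //.
  by apply: (HK n).2 => //; case: (Hw n).
have [|u Hu wu] := hfs_complete wH.
  move=> e e0; have [|n ne] := e_small (e / 2); first by rewrite divr_gt0.
  exists n => k l nk nl; apply: le_lt_trans (w_cauchy k l) _.
  have := e_le _ _ nk; have := e_le _ _ nl; lra.
exists u => // i e e0.
have e20 : 0 < e / 2 by rewrite divr_gt0.
have [n1 n1e] := e_small _ e20.
have /cvgr0_norm_lt/(_ _ e20)[n2 _ Hn2] := wu.
pose n := maxn n1 n2.
(* Any positive slack would serve: only membership in [E i] and closeness to [w n] are used. *)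
have [f [fE _ fw]] := meet i 1 n ltr01.
exists f => //; have Hf := EH _ _ fE.
apply: le_lt_trans (nrmB_trans Hf Hu (wH n)) _.
rewrite nrmBC//.
have := Hn2 n (leq_maxr _ _); rewrite /= ger0_norm ?nrm_ge0//.
rewrite -/(nrm H _); have := e_le _ _ (leq_maxl n1 n2); rewrite -/n; lra.
Qed.

End Adherent.

(** * Finite powers *)

(* The power H^J is a space of functions on [J * T], so that everything proved
   for H applies to tuples. *)
Section Power.
Variables (R : realType) (T : Type) (J : finType) (H : hilbertFunctionSpace R T).
Implicit Types f g : J * T -> R[i].

Definition slice f (j : J) : T -> R[i] := fun x => f (j, x).
Definition pow_mem f : Prop := forall j, H (slice f j).
Definition pow_dot f g : R[i] := \sum_j hdot H (slice f j) (slice g j).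

Lemma slice_eq0 f : (forall j, slice f j = cst 0) -> f = cst 0.
Proof. by move=> f0; apply/funext => -[j x]; have := congr1 (@^~ x) (f0 j). Qed.

Lemma pow_dot_norm_sqr f : pow_mem f ->
  complex.Re (pow_dot f f) = \sum_j nrm H (slice f j) ^+ 2.
Proof.
by move=> Hf; rewrite /pow_dot raddf_sum; apply: eq_bigr => j _; rewrite nrm_sqr.
Qed.

Lemma slice_nrm_le f j : pow_mem f -> nrm H (slice f j) <= dot_norm pow_dot f.
Proof.
move=> Hf; rewrite -[leLHS]ger0_norm ?nrm_ge0// -sqrtr_sqr /dot_norm.
rewrite pow_dot_norm_sqr// ler_wsqrtr// (bigD1 j)//= lerDl.
by apply: sumr_ge0 => k _; rewrite sqr_ge0.
Qed.

(** With [slice_nrm_le], this makes the norm of the power equivalent to the sum of the norms of the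
    slices, so completeness can be checked slice by slice. *)
Lemma pow_dot_norm_le f : pow_mem f -> dot_norm pow_dot f <= \sum_j nrm H (slice f j).
Proof.
move=> Hf; have S0 (P : pred J) : 0 <= \sum_(j | P j) nrm H (slice f j).
  by apply: sumr_ge0 => j _; exact: nrm_ge0.
rewrite -[leRHS]ger0_norm// -sqrtr_sqr /dot_norm pow_dot_norm_sqr//.
apply: ler_wsqrtr; rewrite expr2 mulr_suml; apply: ler_sum => j _.
by rewrite expr2 ler_wpM2l ?nrm_ge0// (bigD1 j)//= lerDl.
Qed.

Fact pow0 : pow_mem (cst 0). Proof. by move=> j; exact: hfs0. Qed.

Fact powD f g : pow_mem f -> pow_mem g -> pow_mem (f \+ g).
Proof. by move=> Hf Hg j; exact: (hfsD (Hf j) (Hg j)). Qed.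

Fact powZ (a : R[i]) f : pow_mem f -> pow_mem (cst a \* f).
Proof. by move=> Hf j; exact: (hfsZ a (Hf j)). Qed.

Fact pow_dotDl f g h : pow_mem f -> pow_mem g -> pow_mem h ->
  pow_dot (f \+ g) h = pow_dot f h + pow_dot g h.
Proof.
move=> Hf Hg Hh; rewrite /pow_dot -big_split; apply: eq_bigr => j _.
exact: (hdotDl (Hf j) (Hg j) (Hh j)).
Qed.

Fact pow_dotZl (a : R[i]) f h : pow_mem f -> pow_mem h ->
  pow_dot (cst a \* f) h = a * pow_dot f h.
Proof.
move=> Hf Hh; rewrite /pow_dot mulr_sumr; apply: eq_bigr => j _.
exact: (hdotZl a (Hf j) (Hh j)).
Qed.

Fact pow_dotC f g : pow_mem f -> pow_mem g -> pow_dot f g = ((pow_dot g f)^*)%C.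
Proof.
move=> Hf Hg; rewrite /pow_dot rmorph_sum; apply: eq_bigr => j _.
exact: (hdotC (Hf j) (Hg j)).
Qed.

Fact pow_dot_gt0 f : pow_mem f -> f <> cst 0 -> 0 < pow_dot f f.
Proof.
move=> Hf f0; rewrite lt_neqAle sumr_ge0 ?andbT; last by move=> j _; exact: hdot_ge0.
apply/eqP => /esym /eqP; rewrite psumr_eq0; last by move=> j _; exact: hdot_ge0.
move=> /allP d0; apply: f0; apply: slice_eq0 => j.
apply: contrapT => /(hdot_gt0 (Hf j)).
by rewrite lt_neqAle (eqP (d0 j (mem_index_enum j))) eqxx.
Qed.

Fact pow_complete (u : nat -> J * T -> R[i]) : (forall n, pow_mem (u n)) ->
  (forall e : R, 0 < e -> exists n0 : nat, forall m n : nat,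
     (n0 <= m)%N -> (n0 <= n)%N -> dot_norm pow_dot (u m \- u n) < e) ->
  exists2 g, pow_mem g & dot_norm pow_dot (u n \- g) @[n --> \oo] --> (0 : R).
Proof.
move=> Hu cu.
have /choice[g Hg] j : exists gj, H gj /\
    nrm H (slice (u n) j \- gj) @[n --> \oo] --> (0 : R).
  have [|gj Hgj ugj] := @hfs_complete _ _ H (fun n => slice (u n) j) (fun n => Hu n j).
    move=> e e0; have [n0 Hn0] := cu e e0; exists n0 => m n n0m n0n.
    apply: le_lt_trans (Hn0 m n n0m n0n).
    have Hmn : pow_mem (u m \- u n) by move=> k; exact: (hfsB (Hu m k) (Hu n k)).
    exact: (slice_nrm_le j Hmn).
  by exists gj.
pose G (p : J * T) := g p.1 p.2.
exists G; first by move=> j; exact: (Hg j).1.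
have HuG n : pow_mem (u n \- G) by move=> j; exact: (hfsB (Hu n j) (Hg j).1).
apply: (@squeeze_cvgr _ _ _ _ (cst 0) (fun n => \sum_j nrm H (slice (u n) j \- g j))).
- by apply: nearW => n; rewrite sqrtr_ge0/=; exact: (pow_dot_norm_le (HuG n)).
- exact: cvg_cst.
- have sum0 : \sum_(j : J) (0 : R) = 0 by rewrite big1.
  have : (\sum_j nrm H (slice (u n) j \- g j)) @[n --> \oo] --> \sum_(j : J) (0 : R).
    by apply: cvg_big => [|j _]; [exact: add_continuous | exact: (Hg j).2].
  by rewrite sum0.
Qed.

Fact pow_eval_continuous (p : J * T) f : pow_mem f ->
  forall e : R, 0 < e -> exists2 d : R, 0 < d &
  forall g, pow_mem g -> dot_norm pow_dot (g \- f) < d -> `|g p - f p| < e%:C.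
Proof.
case: p => j x Hf e e0; have [d d0 Hd] := hfs_eval_continuous x (Hf j) e0.
exists d => // g Hg gfd; apply: (Hd (slice g j) (Hg j)).
apply: le_lt_trans gfd.
have Hgf : pow_mem (g \- f) by move=> k; exact: (hfsB (Hg k) (Hf k)).
exact: (slice_nrm_le j Hgf).
Qed.

Fact pow_eval_neq0 (p : J * T) : exists2 f, pow_mem f & f p != 0.
Proof.
have [f Hf f0] := hfs_eval_neq0 H p.2.
by exists (fun q => f q.2) => // j; exact: Hf.
Qed.

Definition pow_space : hilbertFunctionSpace R (J * T) :=
  HilbertFunctionSpace pow0 powD powZ pow_dotDl pow_dotZl pow_dotC pow_dot_gt0
    pow_complete pow_eval_continuous pow_eval_neq0.

End Power.

(** * Minimax for convex functions *)

Section Minimax.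
Variables (R : realType) (X : Type) (mix : R -> X -> X -> X).

(** [mix s x y] stands for the point of weight [s] at [x] and [1 - s] at [y]. No law of [mix] is
    assumed; convexity is only a property of sets and functions relative to it. *)
Definition convex_in (A : X -> Prop) : Prop :=
  forall s x y, 0 <= s <= 1 -> A x -> A y -> A (mix s x y).

Definition convex_on (A : X -> Prop) (q : X -> R) : Prop :=
  forall s x y, 0 <= s <= 1 -> A x -> A y ->
    q (mix s x y) <= s * q x + (1 - s) * q y.

(** If no point of [A] brings both functions down to [d], each point with a weighted value below [d]
    for some [t] does so only on one side of a threshold. Convexity orders the thresholds, so a
    single [t] between the two kinds leaves every weighted value at least [d], contradicting the
    hypothesis at that [t]. *)
Lemma minimax2 (A : X -> Prop) (p q : X -> R) (c d : R) :
  c < d -> convex_in A -> convex_on A p -> convex_on A q ->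
  (forall t, 0 <= t <= 1 -> exists2 x, A x & (1 - t) * p x + t * q x <= c) ->
  exists x, [/\ A x, p x <= d & q x <= d].
Proof.
move=> cd Acvx pcvx qcvx Apq; apply: contrapT => Nx.
have {}Nx x : A x -> p x <= d -> d < q x.
  by move=> Ax px; rewrite ltNge; apply/negP => qx; apply: Nx; exists x.
(* [x] with [p x < d] satisfies [(1 - t) * p x + t * q x < d] iff
   [t < tau x]; [x] with [q x < d < p x] does iff [t > tau x]. *)
pose tau x := (d - p x) / (q x - p x).
have tau_sep x y : A x -> A y -> p x < d -> q y < d -> tau x <= tau y.
  move=> Ax Ay px qy; have qx := Nx x Ax (ltW px).
  have py : d < p y.
    by rewrite ltNge; apply/negP => /(Nx y Ay)/(lt_trans qy); rewrite ltxx.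
  rewrite leNgt; apply/negP => tyx.
  (* With this weight the chord of [p] takes the value [d], so [p] is at most [d] at the mixed point
     and [q] must exceed [d] there. The reversed order of thresholds would put the chord of [q]
     below [d]. *)
  pose s := (p y - d) / (p y - p x).
  have D0 : 0 < p y - p x by lra.
  have s01 : 0 <= s <= 1.
    apply/andP; split; first by apply: divr_ge0; lra.
    by rewrite ler_pdivrMr//; lra.
  have sE : 1 - s = (d - p x) / (p y - p x) by rewrite /s; field; rewrite gt_eqF.
  have := Nx _ (Acvx s x y s01 Ax Ay).
  have := pcvx s x y s01 Ax Ay; have := qcvx s x y s01 Ax Ay.
  have -> : s * p x + (1 - s) * p y = d by rewrite sE /s; field; rewrite gt_eqF.
  move=> qs ps /(_ ps) dq.
  suff : s * q x + (1 - s) * q y < d by lra.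
  rewrite sE /s -subr_gt0.
  have -> : d - ((p y - d) / (p y - p x) * q x + (d - p x) / (p y - p x) * q y) =
    ((d - p x) * (d - q y) - (p y - d) * (q x - d)) / (p y - p x).
    by field; rewrite gt_eqF.
  rewrite divr_gt0// subr_gt0.
  move: tyx; rewrite /tau ltr_ndivrMr; last lra.
  rewrite mulrAC ltr_pdivrMr; last lra.
  nra.
have tau_le1 x : A x -> p x < d -> tau x <= 1.
  move=> Ax px; have qx := Nx x Ax (ltW px).
  by rewrite /tau ler_pdivrMr; lra.
have [|x0 Ax0 x0c] := Apq 0; first by rewrite lexx ler01.
pose S := [set tau x | x in [set x | A x /\ p x < d]].
have Sx0 : S (tau x0) by exists x0 => //; split=> //; lra.
have S1 : ubound S 1 by move=> _ [x [Ax px] <-]; exact: tau_le1.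
have supS x : A x -> p x < d -> tau x <= sup S.
  by move=> Ax px; apply: (ub_le_sup (ex_intro _ 1 S1)); exists x.
have supS_le x : A x -> q x < d -> sup S <= tau x.
  move=> Ax qx; apply: ge_sup; first by exists (tau x0).
  by move=> _ [y [Ay py] <-]; exact: tau_sep.
have supS01 : 0 <= sup S <= 1.
  have px0 : p x0 < d by lra.
  have qx0 := Nx x0 Ax0 (ltW px0).
  rewrite ge_sup//; last by exists (tau x0).
  rewrite andbT; apply: le_trans (supS x0 Ax0 px0).
  by rewrite /tau divr_ge0//; lra.
have [x Ax xc] := Apq (sup S) supS01.
(* At [t = sup S] the weighted value is at least [d] in each case: [t] is not below [tau x] if
   [p x < d], it is not above [tau x] if [q x < d], and otherwise both values are at least [d]. *)
have [px|px] := ltrP (p x) d.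
  have := supS x Ax px; have := Nx x Ax (ltW px).
  by rewrite /tau => qx; rewrite ler_pdivrMr; nra.
have [qx|qx] := ltrP (q x) d; last first.
  by case/andP: supS01; nra.
have {}px : d < p x.
  by rewrite ltNge; apply/negP => /(Nx x Ax)/(lt_trans qx); rewrite ltxx.
have := supS_le x Ax qx.
by rewrite /tau ler_ndivlMr; nra.
Qed.

Lemma convex_sublevel A p d : convex_in A -> convex_on A p ->
  convex_in (fun x => A x /\ p x <= d).
Proof.
move=> Acvx pcvx s x y s01 [Ax px] [Ay py]; split; first exact: Acvx.
apply: le_trans (pcvx _ _ _ s01 Ax Ay) _; case/andP: s01; nra.
Qed.

Lemma convex_on_sum A n (q : 'I_n -> X -> R) (w : 'I_n -> R) :
  (forall i, 0 <= w i) -> (forall i, convex_on A (q i)) ->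
  convex_on A (fun x => \sum_i w i * q i x).
Proof.
move=> w0 qcvx s x y s01 Ax Ay; rewrite !mulr_sumr -big_split /=.
apply: ler_sum => i _; rewrite !(mulrCA _ (w i)) -mulrDr.
by rewrite ler_wpM2l//; exact: qcvx.
Qed.

(** Induction on the number of functions. On the sublevel set of the first function at a level [e]
    between [c] and [d], the others satisfy the hypothesis with bound [e]: apply [minimax2] to the
    first function and a weighted sum of the others. *)
Lemma minimax n (A : X -> Prop) (q : 'I_n.+1 -> X -> R) (c d : R) :
  c < d -> convex_in A -> (forall i, convex_on A (q i)) ->
  (forall w : 'I_n.+1 -> R, (forall i, 0 <= w i) -> \sum_i w i = 1 ->
     exists2 x, A x & \sum_i w i * q i x <= c) ->
  exists2 x, A x & forall i, q i x <= d.
Proof.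
elim: n A q c d => [|n IHn] A q c d cd Acvx qcvx Aq.
  have [||x Ax] := Aq (fun=> 1); first by move=> _; exact: ler01.
    by rewrite big_ord1.
  rewrite big_ord1 mul1r => qx; exists x => // i.
  by rewrite (ord1 i) (le_trans qx)// ltW.
pose e := (c + d) / 2.
have [ce ed] : c < e /\ e < d by rewrite /e; split; lra.
have A'cvx := convex_sublevel (d := e) Acvx (qcvx ord0).
have [||x [Ax x0] xq] := IHn _ (fun i => q (lift ord0 i)) e d ed A'cvx.
- by move=> i s x y s01 [Ax _] [Ay _]; exact: qcvx.
- move=> w w0 w1.
  have wcvx := convex_on_sum w0 (fun i => qcvx (lift ord0 i)).
  have [|x [Ax x0 xw]] := minimax2 ce Acvx (qcvx ord0) wcvx; last by exists x.
  move=> t /andP[t0 t1].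
  (* The weights of the two-function problem are spread out: [1 - t] for the first function,
     [t * w j] for the others. *)
  pose v i := if unlift ord0 i is Some j then t * w j else 1 - t.
  have v0 : v ord0 = 1 - t by rewrite /v unlift_none.
  have vS j : v (lift ord0 j) = t * w j by rewrite /v liftK.
  have [||x Ax] := Aq v.
  + move=> i; rewrite /v; case: unlift => [j|]; first exact: mulr_ge0.
    by rewrite subr_ge0.
  + rewrite big_ord_recl v0; under eq_bigr do rewrite vS.
    by rewrite -mulr_sumr w1 mulr1 subrK.
  rewrite big_ord_recl v0; under eq_bigr do rewrite vS -mulrA.
  by rewrite -mulr_sumr => xv; exists x.
exists x => // i; have [j ->|->] := unliftP ord0 i; first exact: xq.
exact: le_trans (ltW ed).
Qed.

End Minimax.

(** * Solutions of the Bezout equation *)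

Section Limits.
Variables (R : realType) (T : Type) (H : hilbertFunctionSpace R T).

Lemma nrm_wmean_le (s r : R) (f g : T -> R[i]) : 0 <= s <= 1 -> H f -> H g ->
  nrm H f <= r -> nrm H g <= r -> nrm H (wmean s f g) <= r.
Proof.
move=> s01 Hf Hg fr gr; have r0 := le_trans (nrm_ge0 H f) fr.
move: fr gr; rewrite !nrm_le//; last exact: hfs_wmean.
move=> fr gr; apply: le_trans (hsq_convex s01 Hf Hg) _.
by case/andP: s01 => s0 s1; nra.
Qed.

Lemma adherent_nrm_le (r : R) (u : T -> R[i]) : H u ->
  (forall e, 0 < e -> exists f, [/\ H f, nrm H f <= r + e & nrm H (f \- u) < e]) ->
  nrm H u <= r.
Proof.
move=> Hu Hr; apply/ler_addgt0Pr => e e0.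
have [|f [Hf fr fu]] := Hr (e / 2); first by rewrite divr_gt0.
have -> : u = f \+ (u \- f) by apply/funext => x /=; rewrite addrC subrK.
apply: le_trans (nrmD Hf (hfsB Hu Hf)) _.
by rewrite nrmBC//; lra.
Qed.

Lemma normc_Re (z : R[i]) : `|z| = (complex.Re `|z|)%:C.
Proof. by rewrite normc_def. Qed.

Lemma Re_normc_ge0 (z : R[i]) : 0 <= complex.Re `|z|.
Proof. by have := normr_ge0 z; rewrite lecE => /andP[]. Qed.

Lemma normc_small_eq0 (K : R) (z : R[i]) : 0 <= K ->
  (forall e : R, 0 < e -> `|z| <= (K * e)%:C) -> z = 0.
Proof.
move=> K0 Kz; apply/eqP; rewrite -normr_le0 normc_Re lecR.
apply/ler_addgt0Pr => e e0; rewrite add0r.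
have K1 : 0 < K + 1 by rewrite ltr_wpDl.
have := Kz (e / (K + 1)) (divr_gt0 e0 K1).
rewrite normc_Re lecR => /le_trans; apply.
rewrite mulrCA ger_pMr// ler_pdivrMr//; lra.
Qed.

Lemma normcM_le (z w : R[i]) (r : R) :
  `|w| <= r%:C -> `|z * w| <= (complex.Re `|z| * r)%:C.
Proof.
move=> wr; have -> : (complex.Re `|z| * r)%:C = (complex.Re `|z|)%:C * r%:C.
  exact: rmorphM.
by rewrite -normc_Re normrM ler_wpM2l.
Qed.

(** Makes the Bezout equation at a fixed point stable under norm limits. *)
Lemma eval_sum_bounded (n : nat) (w : 'I_n -> R[i]) (x : 'I_n -> T) :
  exists2 K : R, 0 <= K &
  forall f, H f -> `|\sum_i w i * f (x i)| <= (K * nrm H f)%:C.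
Proof.
have /choice[c Hc] i : exists c : R, 0 <= c /\
    forall f, H f -> `|f (x i)| <= (c * nrm H f)%:C.
  by have [c c0 Hc] := eval_bounded H (x i); exists c.
exists (\sum_i complex.Re `|w i| * c i).
  apply: sumr_ge0 => i _; rewrite mulr_ge0 ?Re_normc_ge0//; exact: (Hc i).1.
move=> f Hf; apply: le_trans (ler_norm_sum _ _ _) _.
rewrite mulr_suml rmorph_sum; apply: ler_sum => i _.
by rewrite -mulrA; apply: normcM_le; exact: (Hc i).2.
Qed.

End Limits.

(** * From the convex Poisson condition to a single solution, and back *)

Section Tuples.
Variables (R : realType) (T : eqType) (H : hilbertFunctionSpace R T) (N : nat).
Let G := pow_space 'I_N H.

Definition uncur (f : 'I_N -> T -> R[i]) : 'I_N * T -> R[i] := fun p => f p.1 p.2.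

Lemma hnorm_tupleE f : (forall l, H (f l)) ->
  hnorm_tuple H f = (nrm G (uncur f))%:E.
Proof.
move=> Hf; rewrite /hnorm_tuple asboolT//; congr (Num.sqrt _)%:E.
by rewrite [RHS]pow_dot_norm_sqr.
Qed.

Lemma hnorm_tuple_leP f (r : R) : (hnorm_tuple H f <= r%:E)%E <->
  (forall l, H (f l)) /\ nrm G (uncur f) <= r.
Proof.
split=> [fr|[Hf fr]]; last by rewrite hnorm_tupleE.
have Hf : forall l, H (f l).
  by apply: contrapT => Nf; move: fr; rewrite /hnorm_tuple asboolF.
by split=> //; rewrite -lee_fin -hnorm_tupleE.
Qed.

Definition kmul (a : T) (F : 'I_N * T -> R[i]) : 'I_N * T -> R[i] :=
  fun p => nkernel H a p.2 * F p.

Lemma kmul_wmean a s F F' : kmul a (wmean s F F') = wmean s (kmul a F) (kmul a F').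
Proof.
by apply/funext => p; rewrite /kmul /wmean /= mulrDr !(mulrCA (nkernel _ _ _)).
Qed.

Hypothesis nkernel_multiplier : forall a, multiplier H (nkernel H a).

Lemma kmul_mem a F : G F -> G (kmul a F).
Proof. by move=> GF l; exact: (nkernel_multiplier a (GF l)). Qed.

Variable phi : 'I_N -> T -> R[i].

Definition solution (F : 'I_N * T -> R[i]) : Prop :=
  G F /\ forall z, \sum_l phi l z * F (l, z) = 1.

Lemma solution_wmean s F F' : solution F -> solution F' -> solution (wmean s F F').
Proof.
move=> [GF F1] [GF' F1']; split; first exact: hfs_wmean.
move=> z; under eq_bigr do rewrite mulrDr !(mulrCA (phi _ _)).
rewrite big_split /= -!mulr_sumr F1 F1' !mulr1 -rmorphD.
by rewrite addrC subrK.
Qed.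

(** The weighted inequalities are exactly the hypothesis of [minimax] for the squared norms on the
    convex set of solutions. The gap between [c] and [d] is the loss which [minimax] requires. *)
Lemma convex_Poisson_finite (c d : R) (a : seq T) :
  convex_Poisson H phi c -> c < d ->
  exists F, [/\ solution F, nrm G F <= d & forall x, x \in a -> nrm G (kmul x F) <= d].
Proof.
move=> [c0 Pc] cd; have d0 := lt_trans c0 cd.
have cd2 : c ^+ 2 < d ^+ 2 by rewrite ltr_pXn2r// nnegrE ltW.
pose b := tnth (in_tuple a).
(* Index [ord0] carries the plain norm, weighted by [theta0]; the other indices carry the points of
   [a]. *)
pose q (i : 'I_(size a).+1) F :=
  if unlift ord0 i is Some m then hsq G (kmul (b m) F) else hsq G F.
have q0 F : q ord0 F = hsq G F by rewrite /q unlift_none.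
have qS m F : q (lift ord0 m) F = hsq G (kmul (b m) F) by rewrite /q liftK.
have [|||F solF Fq] := @minimax R _ (@wmean R _) (size a) solution q _ _ cd2.
- by move=> s F F' _; exact: solution_wmean.
- move=> i s F F' s01 [GF _] [GF' _]; rewrite /q; case: unlift => [m|].
    by rewrite kmul_wmean; apply: hsq_convex => //; exact: kmul_mem.
  exact: hsq_convex.
- move=> w w0 w1; have := w1; rewrite big_ord_recl => w1'.
  have [|g [Hg g1]] := Pc _ b (w ord0) (fun m => w (lift ord0 m)) (w0 _) _ w1'.
    by move=> m; exact: w0.
  have Hkg m l : H (nkernel H (b m) \* g l) by exact: nkernel_multiplier.
  rewrite hnorm_tupleE//.
  under eq_bigr do rewrite hnorm_tupleE// -EFin_expe -EFinM.
  rewrite sumEFin -EFin_expe -EFinM -EFinD lee_fin => gc.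
  exists (uncur g); first by split.
  rewrite big_ord_recl q0; under eq_bigr do rewrite qS.
  rewrite nrm_sqr// in gc; apply: le_trans gc.
  rewrite lerD2l; apply: ler_sum => m _; rewrite ler_wpM2l//.
  by rewrite nrm_sqr; [exact: lexx|exact: Hkg].
exists F; have GF := solF.1; split=> //.
  by rewrite nrm_le ?(ltW d0)// -q0; exact: Fq.
move=> x xa; have ia : (index x a < size a)%N by rewrite index_mem.
rewrite nrm_le ?(ltW d0)//; last exact: kmul_mem.
have := Fq (lift ord0 (Ordinal ia)); rewrite qS /b (tnth_nth x) /=.
by rewrite nth_index.
Qed.

(** The slack in the hypothesis allows [C] to be the infimum of the admissible constants before that
    infimum is known to be admissible. *)
Lemma convex_Poisson_solution (C : R) :
  (forall e, 0 < e -> exists2 c, convex_Poisson H phi c & c < C + e) ->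
  exists F, [/\ solution F, nrm G F <= C & forall x, nrm G (kmul x F) <= C].
Proof.
move=> PC; pose e_ (n : nat) : R := n.+1%:R^-1.
have e_gt0 n : 0 < e_ n by rewrite invr_gt0 ltr0n.
have e_le m n : (m <= n)%N -> e_ n <= e_ m by exact: ler_invS.
have e_small e : 0 < e -> exists n, e_ n < e by exact: invS_small.
have e_le1 n : e_ n <= 1 by rewrite invf_le1 ?ltr0n// ler1n.
have half01 : 0 <= (2^-1 : R) <= 1 by lra.
(* Concatenating the lists and taking the larger integer gives a smaller set, so the family is
   directed. *)
pose E (p : seq T * nat) F := [/\ solution F, nrm G F <= C + e_ p.2 &
  forall x, x \in p.1 -> nrm G (kmul x F) <= C + e_ p.2].
have Emid p F F' : E p F -> E p F' -> E p (wmean 2^-1 F F').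
  move=> [sF Fp kF] [sF' Fp' kF']; split; first exact: solution_wmean.
    by apply: nrm_wmean_le => //; [exact: sF.1|exact: sF'.1].
  move=> x xp; rewrite kmul_wmean; apply: nrm_wmean_le => //.
  - by apply: kmul_mem; exact: sF.1.
  - by apply: kmul_mem; exact: sF'.1.
  - exact: kF.
  - exact: kF'.
have Ene p : exists F, E p F.
  have [c Pc cC] := PC _ (e_gt0 p.2).
  by have [F [sF Fd kF]] := convex_Poisson_finite p.1 Pc cC; exists F.
have Esub a n m F : (n <= m)%N -> E (a, m) F -> E (a, n) F.
  move=> nm [sF /= Fm kF]; have := e_le _ _ nm => enm; split=> //=; first lra.
  by move=> x /kF /=; lra.
have [| | | | |u Gu uE] := @directed_adherent R _ G _ E (C + 1).
- exact: (inhabits ([::], 0%N)).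
- by move=> p F [[]].
- exact: Emid.
- move=> [a m] [b n]; exists (a ++ b, maxn m n) => F EF; split.
    apply: (Esub _ _ _ _ (leq_maxl m n)); case: EF => sF Fm kF; split=> //.
    by move=> x xa; apply: kF; rewrite /= mem_cat xa.
  apply: (Esub _ _ _ _ (leq_maxr m n)); case: EF => sF Fm kF; split=> //.
  by move=> x xa; apply: kF; rewrite /= mem_cat xa orbT.
- move=> p; have [F EF] := Ene p; exists F => //; case: EF => _ Fp _.
  by apply: le_trans Fp _; rewrite lerD2l.
exists u; split.
- split=> // z; have [K K0 HK] := eval_sum_bounded G (phi^~ z) (fun l => (l, z)).
  apply/esym/eqP; rewrite -subr_eq0; apply/eqP/(normc_small_eq0 K0) => e e0.
  have [F [[GF F1] _ _] Fu] := uE ([::], 0%N) e e0.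
  rewrite -(F1 z) -sumrB; under eq_bigr do rewrite -mulrBr.
  apply: le_trans (HK _ (hfsB GF Gu)) _.
  by rewrite lecR ler_wpM2l// ltW.
- apply: adherent_nrm_le => // e e0; have [n ne] := e_small e e0.
  have [F [[GF _] Fn _] Fu] := uE ([::], n) e e0; exists F; split=> //.
  by apply: le_trans Fn _; rewrite lerD2l ltW.
move=> x.
(* Besides the bound at [x], [F] is kept close to [u], so that any limit of the products can be
   identified with [kmul x u]. *)
pose K n h := exists F, [/\ E ([:: x], n) F, nrm G (F \- u) <= e_ n & h = kmul x F].
have KG n h : K n h -> G h.
  by move=> [F [[[GF _] _ _] _ ->]]; exact: kmul_mem.
have KC n h : K n h -> nrm G h <= C + e_ n.
  by move=> [F [[_ _ kF] _ ->]]; apply: kF; rewrite /= mem_seq1.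
have [| | | | |h Gh hK] := @directed_adherent R _ G _ K (C + 1).
- exact: (inhabits 0%N).
- exact: KG.
- move=> n _ _ [F [EF Fu ->]] [F' [EF' Fu' ->]]; exists (wmean 2^-1 F F').
  have [[[GF _] _ _] [[GF' _] _ _]] := (EF, EF').
  split; [exact: Emid| |by rewrite kmul_wmean].
  have -> : wmean 2^-1 F F' \- u = wmean 2^-1 (F \- u) (F' \- u).
    apply/funext => p; rewrite /wmean /= !mulrBr addrACA -opprD -mulrDl -rmorphD.
    by rewrite (addrC 2^-1) subrK mul1r.
  by apply: nrm_wmean_le => //; exact: hfsB.
- move=> m n; exists (maxn m n) => h [F [EF Fu ->]]; split; exists F; split=> //.
  + exact: Esub (leq_maxl m n) EF.
  + exact: le_trans Fu (e_le _ _ (leq_maxl m n)).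
  + exact: Esub (leq_maxr m n) EF.
  + exact: le_trans Fu (e_le _ _ (leq_maxr m n)).
- move=> n; have [F EF Fu] := uE ([:: x], n) (e_ n) (e_gt0 n).
  have KF : K n (kmul x F) by exists F; split=> //; exact: ltW.
  by exists (kmul x F) => //; apply: le_trans (KC _ _ KF) _; rewrite lerD2l.
suff <- : h = kmul x u.
  apply: adherent_nrm_le => // e e0; have [n ne] := e_small e e0.
  have [f fK fh] := hK n e e0; exists f; split=> //; first exact: KG fK.
  by apply: le_trans (KC _ _ fK) _; rewrite lerD2l ltW.
apply/funext => p; have [c c0 Hc] := eval_bounded G p.
set k := nkernel H x p.2.
have kc0 : 0 <= c * (1 + complex.Re `|k|).
  by rewrite mulr_ge0// addr_ge0// Re_normc_ge0.
apply/eqP; rewrite -subr_eq0; apply/eqP/(normc_small_eq0 kc0) => e e0.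
have [n ne] := e_small e e0.
have [f fK fh] := hK n e e0; have Gf := KG _ _ fK.
have [F [[[GF _] _ _] Fu fE]] := fK.
(* Both differences are small in norm, hence at [p]. The kernel enters only through its value [k] at
   that point, so no operator bound for multiplication is needed. *)
have -> : h p - kmul x u p = k * (F \- u) p - (f \- h) p.
  by rewrite fE /kmul /= -/k; ring.
apply: le_trans (ler_normB _ _) _.
have -> : (c * (1 + complex.Re `|k|) * e)%:C =
    (complex.Re `|k| * (c * e))%:C + (c * e)%:C.
  by rewrite -rmorphD; congr (_%:C); ring.
apply: lerD; [apply: normcM_le|]; apply: le_trans (Hc _ (hfsB _ _)) _ => //;
  by rewrite lecR ler_wpM2l// ltW//; exact: le_lt_trans Fu ne.
Qed.

Lemma kernel_multiplier_norm_tuple_leP f (C : R) :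
  (kernel_multiplier_norm_tuple H f <= C%:E)%E <->
  [/\ forall l, H (f l), nrm G (uncur f) <= C &
      forall x, nrm G (kmul x (uncur f)) <= C].
Proof.
have fkE x : (fun l => f l \* nkernel H x) = (fun l => nkernel H x \* f l).
  by apply/funext => l; apply/funext => y /=; rewrite mulrC.
rewrite /kernel_multiplier_norm_tuple ge_max; split.
  move=> /andP[/hnorm_tuple_leP[Hf fC] kC]; split=> // x.
  suff /hnorm_tuple_leP[] : (hnorm_tuple H (fun l => nkernel H x \* f l)%R <= C%:E)%E.
    by [].
  by apply: le_trans kC; apply: ereal_sup_ubound; exists x => //; rewrite fkE.
move=> [Hf fC kC]; apply/andP; split; first exact/hnorm_tuple_leP.
apply: ge_ereal_sup => _ [x _ <-]; rewrite fkE.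
apply/hnorm_tuple_leP; split; last exact: kC.
by move=> l; exact: nkernel_multiplier.
Qed.

(** The same [f] serves for all points and weights: a convex combination of squared norms, each at
    most [C ^+ 2], is at most [C ^+ 2]. *)
Lemma convex_Poisson_of_solution f (C : R) : 0 < C -> bezout phi f ->
  (kernel_multiplier_norm_tuple H f <= C%:E)%E -> convex_Poisson H phi C.
Proof.
move=> C0 f1 /kernel_multiplier_norm_tuple_leP[Hf fC kC]; split=> //.
move=> M a t0 t t0_ge0 t_ge0 t1; exists f; split=> //.
have Hkf m l : H (nkernel H (a m) \* f l) by exact: nkernel_multiplier.
rewrite hnorm_tupleE//.
under eq_bigr do rewrite hnorm_tupleE// -EFin_expe -EFinM.
rewrite sumEFin -EFin_expe -EFinM -EFinD lee_fin.
rewrite -[leRHS]mul1r -t1 mulrDl mulr_suml; apply: lerD.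
  by rewrite ler_wpM2l// ler_pXn2r// nnegrE ?nrm_ge0 ?ltW.
apply: ler_sum => m _.
by rewrite ler_wpM2l// ler_pXn2r// ?nnegrE ?nrm_ge0 ?(ltW C0)//; exact: kC.
Qed.

End Tuples.

(** * Bounded kernel multiplier solutions and the smallest convex Poisson constant *)

Theorem theorem20 (R : realType) (Omega : topologicalType)
    (H : hilbertFunctionSpace R Omega)
    (Omega_separable : separable Omega)
    (H_stable : multiplier_stable H)
    (H_continuous : forall f : Omega -> R[i], H f ->
       continuous (f : Omega -> R[i]^o))
    (H_cst : forall c : R[i], H (cst c))
    (H_norm1 : hnorm H (cst 1) = 1%E)
    (H_Montel : Montel H)
    (N : nat) (N_ge1 : (1 <= N)%N)
    (phi : 'I_N -> Omega -> R[i])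
    (phi_bounded : forall l, bounded_fun (phi l : Omega -> R[i]^o))
    (C : R) (C_gt0 : 0 < C) :
  (exists f : 'I_N -> Omega -> R[i],
     [/\ forall l, kernel_multiplier H (f l),
         bezout phi f &
         (kernel_multiplier_norm_tuple H f <= C%:E)%E])
  <->
  (exists2 c : R, is_convex_Poisson_norm H phi c & c <= C).
Proof.
have k_mult a : multiplier H (nkernel H a).
  move=> f Hf; have [_ ka _] := H_stable.1 a.
  have -> : nkernel H a \* f = cst (sqrtC (rkernel H a a))^-1 \* (rkernel H a \* f).
    by apply/funext => y; rewrite /nkernel /= mulrAC mulrC.
  by apply: hfsZ; exact: ka.
(* On an empty set the constants 1 and 0 would coincide, against the norm of 1. The point [z] serves
   below to rule out a zero infimum. *)
have [z _] : exists z : Omega, True.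
  apply: contrapT => Omega0; move: H_norm1.
  have -> : cst 1 = cst 0 :> (Omega -> R[i]).
    by apply/funext => z; case: Omega0; exists z.
  rewrite /hnorm asboolT; last exact: hfs0.
  by rewrite /dot_norm hdot0 sqrtr0 => -[] /esym/eqP; rewrite oner_eq0.
split=> [[f [_ f1 fC]]|[c [Pc _] cC]].
  have PC := convex_Poisson_of_solution k_mult C_gt0 f1 fC.
  pose S := [set c | convex_Poisson H phi c].
  have S0 : lbound S 0 by move=> c [/ltW].
  have infS : has_inf S by split; [exists C|exists 0].
  have inf_ge0 : 0 <= inf S by apply: lb_le_inf => //; exists C.
  (* A solution bounded by [inf S] itself shows that the smallest constant exists. *)
  have [|F [[GF F1] FC kC]] := @convex_Poisson_solution _ _ _ _ k_mult phi (inf S).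
    by move=> e e0; have [c] := inf_adherent e0 infS; exists c.
  (* Admissible constants are positive by definition. A zero infimum would force [F = cst 0], which
     violates the Bezout equation at [z]. *)
  have inf_gt0 : 0 < inf S.
    rewrite lt_neqAle inf_ge0 andbT eq_sym; apply/eqP => inf0.
    have F0 : F = cst 0.
      by apply: (nrm_eq0 GF); apply/le_anti; rewrite nrm_ge0 -inf0 FC.
    have := F1 z; rewrite F0 big1 => [/esym/eqP|l _]; first by rewrite oner_eq0.
    exact: mulr0.
  exists (inf S); last exact: (ge_inf (ex_intro _ 0 S0)).
  split; last by move=> c Sc; exact: (ge_inf (ex_intro _ 0 S0)).
  apply: (convex_Poisson_of_solution k_mult inf_gt0 (f := slice F)) => //.
  apply/(kernel_multiplier_norm_tuple_leP k_mult).
  have -> : uncur (slice F) = F by apply/funext => -[].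
  by split.
have [|F [[GF F1] FC kC]] := @convex_Poisson_solution _ _ _ _ k_mult phi C.
  by move=> e e0; exists c => //; rewrite (le_lt_trans cC)// ltrDl.
exists (slice F).
have FCk : (kernel_multiplier_norm_tuple H (slice F) <= C%:E)%E.
  apply/(kernel_multiplier_norm_tuple_leP k_mult).
  have -> : uncur (slice F) = F by apply/funext => -[].
  by split.
split=> // l; rewrite /kernel_multiplier.
(* Each component is a kernel multiplier because the norm of a slice is at most that of the
   tuple. *)
have Hl a : H (slice F l \* nkernel H a).
  have -> : slice F l \* nkernel H a = nkernel H a \* slice F l.
    by apply/funext => y /=; rewrite mulrC.
  exact: k_mult.
apply: (@le_lt_trans _ _ C%:E); last exact: ltry.
rewrite ge_max; apply/andP; split.
  rewrite /hnorm asboolT// lee_fin; apply: le_trans FC.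
  exact: (slice_nrm_le l GF).
apply: ge_ereal_sup => _ [a _ <-]; rewrite /hnorm asboolT// lee_fin.
apply: le_trans (kC a).
have -> : slice F l \* nkernel H a = slice (kmul H a F) l.
  by apply/funext => y; rewrite /slice /kmul /= mulrC.
by apply: slice_nrm_le => j; exact: (k_mult a _ (GF j)).
Qed.
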